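(* Consider the fading cognitive broadcast channel described in the context, whose ergodic sum capacity is the optimal value of $$\max_{\{p_k(\boldsymbol{\beta})\ge0\}}\ \mathbb{E}\Big[\log\Big(1+\sum_{k=1}^K h_kp_k(\boldsymbol{\beta})\Big)\Big]$$ with $q(\boldsymbol{\beta})=\sum_{k=1}^Kp_k(\boldsymbol{\beta})$, subject to one of: Case I: $\mathbb{E}[q(\boldsymbol{\beta})]\le Q^{\rm LT}$ and $\mathbb{E}[f_mq(\boldsymbol{\beta})]\le\Gamma_m^{\rm LT}\ \forall m$; Case II: $\mathbb{E}[q(\boldsymbol{\beta})]\le Q^{\rm LT}$ and $f_mq(\boldsymbol{\beta})\le\Gamma_m^{\rm ST}\ \forall m,\forall\boldsymbol{\beta}$; Case III: $q(\boldsymbol{\beta})\le Q^{\rm ST}\ \forall\boldsymbol{\beta}$ and $\mathbb{E}[f_mq(\boldsymbol{\beta})]\le\Gamma_m^{\rm LT}\ \forall m$; Case IV: $q(\boldsymbol{\beta})\le Q^{\rm ST}$ and $f_mq(\boldsymbol{\beta})\le\Gamma_m^{\rm ST}\ \forall m,\forall\boldsymbol{\beta}$. In each of Cases I–IV, D-TDMA is optimal across all fading states: there is an optimal policy in which at each fading state only the user $i$ with the largest $h_i$ among all users is allocated positive power, and the transmit power $q^*=p_i$ at that state is given (with $m'=\arg\min_{m}\Gamma_m^{\rm ST}/f_m$, and $\lambda$, $\mu_m$ the optimal dual variables associated with the long-term transmit-power constraint and the long-term interference-power constraints, respectively, when present) by: Case I: $q^*=\Big(\frac{1}{\lambda+\sum_{m=1}^M\mu_mf_m}-\frac{1}{h_i}\Big)^+$;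 Case II: $q^*=\min\Big(\frac{\Gamma_{m'}^{\rm ST}}{f_{m'}},\Big(\frac{1}{\lambda}-\frac{1}{h_i}\Big)^+\Big)$; Case III: $q^*=\min\Big(Q^{\rm ST},\Big(\frac{1}{\sum_{m=1}^M\mu_mf_m}-\frac{1}{h_i}\Big)^+\Big)$; Case IV: $q^*=\min\Big(Q^{\rm ST},\frac{\Gamma_{m'}^{\rm ST}}{f_{m'}}\Big)$.
   Context: Setting: a secondary base station transmits to $K$ secondary users in the presence of $M$ primary receivers, all single-antenna. The channel state is the random vector $\boldsymbol{\beta}=(h_1,\ldots,h_K,f_1,\ldots,f_M)$ of nonnegative power gains, $h_k$ from the base station to user $k$ and $f_m$ from the base station to primary receiver $m$; the $f_m$'s are mutually independent and independent of the $h_k$'s, and $\boldsymbol{\beta}$ has a continuous, differentiable joint cumulative distribution function; noise at each user has unit variance. By MAC–BC duality the ergodic sum capacity of the broadcast channel equals the optimal value of the displayed problem, in which $p_k(\boldsymbol{\beta})\ge0$ are the user powers in the dual multiple-access channel and $q(\boldsymbol{\beta})=\sum_kp_k(\boldsymbol{\beta})$ is the base-station transmit power. $Q^{\rm LT},Q^{\rm ST},\Gamma_m^{\rm LT},\Gamma_m^{\rm ST}>0$ are given limits; expectations are over $\boldsymbol{\beta}$. The optimal dual variables are the minimizers of the Lagrange dual problem obtained by dualizing the long-term constraints with nonnegative multipliers $\lambda$ (for $\mathbb{E}[q]\le Q^{\rm LT}$) and $\mu_m$ (for $\mathbb{E}[f_mq]\le\Gamma_m^{\rm LT}$). Conventions: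 $1/0=+\infty$, $(x)^+=\max(0,x)$.
   Formalization: Cases I–III assume the optimal dual value is finite (otherwise every multiplier is a minimizer and the formulas can be infeasible); the power formulas are asserted for almost every fading state, since they can be infinite on null sets (e.g. λ=0 and all f_m=0). *)

(* Defs.v *)
From HB Require Import structures.
From mathcomp Require Import all_boot all_order all_algebra.
From mathcomp Require Import all_classical all_reals all_analysis.
Set Implicit Arguments. Unset Strict Implicit. Unset Printing Implicit Defensive.
Import Order.TTheory GRing.Theory Num.Theory.
Import numFieldNormedType.Exports.
Local Open Scope ring_scope.
Local Open Scope classical_set_scope.

(* A power-allocation policy maps a channel state
   beta = (h_1..h_K, f_1..f_M) to the user powers p_1..p_K (dual MAC). *)
Definition policy (R : realType) (K M : nat) :=
  ('I_K -> R) -> ('I_M -> R) -> 'I_K -> R.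

Section CBC.
Context {R : realType} {d : measure_display} {T : measurableType d}.
Variables (P : probability T R) (K M : nat)
          (h : 'I_K -> T -> R) (f : 'I_M -> T -> R).

Definition hst (x : T) : 'I_K -> R := fun k => h k x.
Definition fst_ (x : T) : 'I_M -> R := fun m => f m x.

Definition pw (p : policy R K M) (x : T) (k : 'I_K) : R := p (hst x) (fst_ x) k.
Definition tpow (p : policy R K M) (x : T) : R := \sum_(k < K) pw p x k.
Definition rate (p : policy R K M) (x : T) : R :=
  ln (1 + \sum_(k < K) h k x * pw p x k).

Definition Obj (p : policy R K M) : \bar R := (\int[P]_x (rate p x)%:E)%E.
Definition Eq (p : policy R K M) : \bar R := (\int[P]_x (tpow p x)%:E)%E.
Definition Efq (p : policy R K M) (m : 'I_M) : \bar R :=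
  (\int[P]_x (f m x * tpow p x)%:E)%E.

Definition basic_policy (p : policy R K M) : Prop :=
  (forall k, measurable_fun setT (fun x => pw p x k)) /\
  (forall hs fs k, 0 <= p hs fs k).

Definition feasible (ltQ ltG : bool) (QLT QST : R) (GLT GST : 'I_M -> R)
  (p : policy R K M) : Prop :=
  basic_policy p /\
  (if ltQ then ((Eq p <= QLT%:E)%E : Prop) else forall x, tpow p x <= QST) /\
  (if ltG then forall m, ((Efq p m <= (GLT m)%:E)%E : Prop)
          else forall m x, f m x * tpow p x <= GST m).

Definition optimal_policy ltQ ltG QLT QST GLT GST (p : policy R K M) : Prop :=
  feasible ltQ ltG QLT QST GLT GST p /\
  forall p', feasible ltQ ltG QLT QST GLT GST p' -> (Obj p' <= Obj p)%E.

(* policies over which the Lagrangian is maximised: only the short-term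
   constraints are kept, the long-term ones are dualised *)
Definition dual_domain (ltQ ltG : bool) (QST : R) (GST : 'I_M -> R) :
  set (policy R K M) :=
  [set p | basic_policy p /\
     (~~ ltQ -> forall x, tpow p x <= QST) /\
     (~~ ltG -> forall m x, f m x * tpow p x <= GST m)].

Definition lagrangian (ltQ ltG : bool) (QLT : R) (GLT : 'I_M -> R)
  (lam : R) (mu : 'I_M -> R) (p : policy R K M) : \bar R :=
  (Obj p
   - (if ltQ then lam%:E * (Eq p - QLT%:E) else 0)
   - (if ltG then \sum_(m < M) (mu m)%:E * (Efq p m - (GLT m)%:E) else 0))%E.

Definition dual_fun ltQ ltG QLT QST GLT GST lam mu : \bar R :=
  ereal_sup [set lagrangian ltQ ltG QLT GLT lam mu p
            | p in dual_domain ltQ ltG QST GST].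

Definition dual_optimal ltQ ltG QLT QST GLT GST (lam : R) (mu : 'I_M -> R)
  : Prop :=
  0 <= lam /\ (forall m, 0 <= mu m) /\
  forall lam' mu', 0 <= lam' -> (forall m, 0 <= mu' m) ->
    (dual_fun ltQ ltG QLT QST GLT GST lam mu
     <= dual_fun ltQ ltG QLT QST GLT GST lam' mu')%E.

(* D-TDMA at the fading state realised at x, with transmit power q:
   some user i with the largest h_i gets power q i (the formula may
   depend on h_i), all others get 0. *)
Definition dtdma_at (p : policy R K M) (q : 'I_K -> \bar R) (x : T) : Prop :=
  exists i : 'I_K, (forall k, h k x <= h i x) /\
    (forall k, k != i -> pw p x k = 0) /\ (pw p x i)%:E = q i.

(* mutual independence of the random vector (h_1..h_K) and f_1, ..., f_M,
   stated on generating rectangles *)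
Definition indep_h_f : Prop :=
  forall (A : 'I_K -> set R) (B : 'I_M -> set R),
    (forall k, measurable (A k)) -> (forall m, measurable (B m)) ->
    P ([set x | forall k, A k (h k x)] `&` [set x | forall m, B m (f m x)]) =
    (P [set x | forall k, A k (h k x)] *
       \prod_(m < M) P [set x | B m (f m x)])%E.

Definition joint_cdf (v : 'rV[R]_(K + M)) : R :=
  fine (P [set x | (forall k : 'I_K, h k x <= v ord0 (lshift M k)) /\
                   (forall m : 'I_M, f m x <= v ord0 (rshift K m))]).

End CBC.

Definition einv {R : realType} (x : R) : \bar R :=
  if x == 0 then +oo%E else (x^-1)%:E.

Definition epos {R : realType} (x : \bar R) : \bar R := Order.max x 0%E.

(* Gamma_{m'}^ST / f_{m'} with m' = argmin_m Gamma_m^ST / f_m,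
   i.e. min_m Gamma_m^ST / f_m (with Gamma/0 = +oo) *)
Definition min_ratio {R : realType} {M : nat} (GST fs : 'I_M -> R) : \bar R :=
  \big[Order.min/+oo%E]_(m < M)
     (if fs m == 0 then +oo%E else (GST m / fs m)%:E).

(* Main.v *)
Require Import Defs.
From HB Require Import structures.
From mathcomp Require Import all_boot all_order all_algebra.
From mathcomp Require Import all_classical all_reals all_analysis.
From mathcomp Require Import measurable_realfun ring lra.
Import Order.TTheory GRing.Theory Num.Theory.
Import numFieldNormedType.Exports.
Local Open Scope ring_scope.
Local Open Scope classical_set_scope.
Set Implicit Arguments. Unset Strict Implicit. Unset Printing Implicit Defensive.

(* The total price of power at a state is [a = lambda + sum_m mu_m f_m]; with
   [H = max_k h_k] and the peak power [c] imposed by the short-term constraints,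
   the maximiser of [ln (1 + H s) - a s] over [0 <= s <= c] is
   [q = min (c, (1/a - 1/H)^+)], and giving all of it to a best user loses
   nothing.  Hence water-filling maximises the Lagrangian, and it is primal
   optimal as soon as it is feasible with [E (a q) >= C], where [C] is the
   priced long-term budget.  Both come from the subgradient inequality
   [C - E (a q') <= C' - E (a' q')], [q'] being water-filling at another price
   [a']: raising one price by [t] bounds the corresponding long-term average of
   [q'], and [q'] increases to [q] as [t] tends to [0] (monotone convergence);
   scaling all the prices by [1 / (1 + s)] gives [E (a q) >= C - s].  The
   continuity of the distribution function makes all gains positive almost
   surely. *)

(* First-order optimality of the power [q] for the gain [H], the price [a] and
   the peak power [c]: the derivative of [ln (1 + H s) - a s] at [q] is
   [(H - a (1 + H q)) / (1 + H q)]. *)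
Definition kkt {R : realType} (c : \bar R) (a H q : R) : Prop :=
  [/\ 0 <= q, (q%:E <= c)%E &
      forall s, 0 <= s -> (s%:E <= c)%E -> (s - q) * (H - a * (1 + H * q)) <= 0].

(** * One-dimensional water-filling and its dependence on the price *)

Section kkt_theory.
Context {R : realType}.
Implicit Types (c : \bar R) (a H q s : R).

(** The derivative vanishes at [1/a - 1/H]; if this is not positive then [H <= a] and the optimum is
    [0], and if it exceeds [c] the derivative is still nonnegative at [c]. At [a = 0] the water
    level is infinite and the finite cap binds. *)
Lemma waterfill_kkt c a H : 0 <= a -> 0 < H -> (0 <= c)%E ->
  (c = +oo%E -> 0 < a) ->
  exists2 q, Order.min c (epos (einv a - einv H))%E = q%:E & kkt c a H q.
Proof.
move=> a0 H0 c0 ca.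
rewrite {2}/einv (gt_eqF H0) /einv.
have HV : H * H^-1 = 1 by rewrite divff// gt_eqF.
have HV0 : 0 < H^-1 by rewrite invr_gt0.
have [a_eq0|a_neq0] := eqVneq a 0.
  rewrite addye// /epos maxye miney.
  case: c c0 ca => [r| |] //= r0 ca; last by have := ca erefl; rewrite a_eq0 ltxx.
  exists r => //; split=> // s s0; rewrite lee_fin a_eq0 => sr.
  by rewrite mul0r subr0; nra.
have {}a0 : 0 < a by rewrite lt_neqAle eq_sym a_neq0.
have aV : a * a^-1 = 1 by rewrite divff// gt_eqF.
have aV0 : 0 < a^-1 by rewrite invr_gt0.
rewrite -EFinB /epos -EFin_max.
set u := Order.max _ _.
have [u0 uH] : 0 <= u /\ (u = 0 /\ H <= a \/ a * (1 + H * u) = H).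
  rewrite /u; case: (lerP (a^-1 - H^-1) 0) => uu.
    split=> //; left; split=> //.
    have : a * H * (a^-1 - H^-1) <= 0
      by apply: mulr_ge0_le0 => //; apply: mulr_ge0; exact: ltW.
    suff -> : a * H * (a^-1 - H^-1) = H * (a * a^-1) - a * (H * H^-1) by rewrite aV HV; lra.
    by ring.
  split; first exact: ltW.
  right; have -> : a * (1 + H * (a^-1 - H^-1)) = a + H * (a * a^-1) - a * (H * H^-1) by ring.
  by rewrite aV HV; lra.
case: c c0 {ca} => [r| |] //= r0; last first.
  rewrite minye; exists u => //; split=> // [|s s0 _]; first by rewrite leey.
  by case: uH => [[-> ?]|->]; nra.
rewrite -EFin_min; exists (Order.min r u) => //.
rewrite lee_fin in r0.
split; first by rewrite le_min r0 u0.
  by rewrite lee_fin ge_min lexx.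
move=> s s0; rewrite lee_fin => sr.
case: (lerP r u) => ru; last by case: uH => [[-> ?]|->]; nra.
case: uH => [[u_eq0 Ha]|aH].
  have -> : r = 0 by apply/le_anti; rewrite -{1}u_eq0 ru r0.
  by nra.
apply: mulr_le0_ge0; first by rewrite subr_le0.
by rewrite -{1}aH subr_ge0 ler_pM2l// lerD2l ler_pM2l.
Qed.

(** Testing [kkt] against one admissible power beyond [q] fixes the sign of the derivative; the
    comparisons of optima below rest on this and on its mirror image [kkt_gt]. *)
Lemma kkt_lt c a H q s : kkt c a H q -> 0 <= s -> (s%:E <= c)%E -> q < s ->
  H <= a * (1 + H * q).
Proof.
move=> [_ _ K] s0 sc qs; have := K s s0 sc.
by rewrite pmulr_rle0 ?subr_gt0// subr_le0.
Qed.

Lemma kkt_gt c a H q s : kkt c a H q -> 0 <= s -> (s%:E <= c)%E -> s < q ->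
  a * (1 + H * q) <= H.
Proof.
move=> [_ _ K] s0 sc sq; have := K s s0 sc.
by rewrite nmulr_rle0 ?subr_lt0// subr_ge0.
Qed.

(** Comparison with zero power gives [a (1 + H q) <= H] when [q > 0]. The bound does not depend on
    the state, so the expected cost of water-filling is finite. *)
Lemma kkt_price_le1 c a H q : 0 <= a -> 0 < H -> (0 <= c)%E ->
  kkt c a H q -> a * q <= 1.
Proof.
move=> a0 H0 c0 [q0 qc /(_ 0 (lexx _) c0)]; rewrite sub0r => Hk.
have [->|qN0] := eqVneq q 0; first by rewrite mulr0 ler01.
have {}q0 : 0 < q by rewrite lt_neqAle eq_sym qN0.
have : 0 <= H - a * (1 + H * q).
  by rewrite -(pmulr_rge0 _ q0); move: Hk; rewrite mulNr oppr_le0.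
move=> h1; rewrite -(ler_pM2l H0) mulr1; nra.
Qed.

(** Here [s] is the total power of a competitor and [t] its received power. Concavity of [ln] bounds
    [ln ((1 + H s) / (1 + H q))] by [H (s - q) / (1 + H q)], and [kkt] bounds this by
    [a (s - q)]. *)
Lemma kkt_opt c a H q s t : 0 <= a -> 0 < H -> kkt c a H q ->
  0 <= s -> (s%:E <= c)%E -> 0 <= t -> t <= H * s ->
  ln (1 + t) + a * q <= ln (1 + H * q) + a * s.
Proof.
move=> a0 H0 [q0 qc /(_ s)] Hk s0 sc t0 ts.
have {}Hk := Hk s0 sc.
have d0 : 0 < 1 + H * q by nra.
have n0 : 0 < 1 + H * s by nra.
have : ln (1 + t) <= ln (1 + H * s) by rewrite ler_ln ?posrE//; lra.
suff : ln (1 + H * s) - ln (1 + H * q) <= a * s - a * q by lra.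
rewrite -ln_div ?posrE//.
have -> : (1 + H * s) / (1 + H * q) = 1 + H * (s - q) / (1 + H * q).
  by field; rewrite gt_eqF.
apply: (le_trans (le_ln1Dx _)).
  have : 0 < (1 + H * s) / (1 + H * q) by rewrite divr_gt0.
  suff -> : (1 + H * s) / (1 + H * q) = 1 + H * (s - q) / (1 + H * q) by lra.
  by field; rewrite gt_eqF.
by rewrite ler_pdivrMr//; nra.
Qed.

(** If [q < q'], then [H <= a (1 + H q)] and [a' (1 + H q') <= H], which is impossible for [a <= a']
    and [0 < a']. *)
Lemma kkt_le c a a' H q q' : 0 <= a -> a <= a' -> 0 < H ->
  kkt c a H q -> kkt c a' H q' -> q' <= q.
Proof.
move=> a0 aa' H0 K K'; have [q0 qc _] := K; have [q'0 q'c _] := K'.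
rewrite leNgt; apply/negP => qq'.
have k := kkt_lt K q'0 q'c qq'; have k' := kkt_gt K' q0 qc qq'.
have aq : a * (1 + H * q) <= a' * (1 + H * q) by apply: ler_wpM2r => //; nra.
have : 0 < a'.
  rewrite lt_neqAle (le_trans a0 aa') andbT eq_sym; apply/eqP => a'0.
  have az : a = 0 by (apply/le_anti; rewrite a0 andbT -a'0).
  by move: k; rewrite az mul0r leNgt H0.
have : 0 < q' - q by rewrite subr_gt0.
move=> d0 a'0; have : 0 < a' * H * (q' - q) by rewrite !mulr_gt0.
nra.
Qed.

(** If the power grows, [H <= a (1 + H q)] and [a (1 + H q') <= H (1 + s)]; subtract and divide by
    [H]. *)
Lemma kkt_scale c a H q q' s : 0 <= a -> 0 < H -> 0 < s ->
  kkt c a H q -> kkt c (a / (1 + s)) H q' -> a * q' <= a * q + s.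
Proof.
move=> a0 H0 s0 K K'; have [q0 qc _] := K; have [q'0 q'c _] := K'.
have [le_q|lt_q] := leP q' q; first by have := ler_wpM2l a0 le_q; lra.
have k := kkt_lt K q'0 q'c lt_q; have k' := kkt_gt K' q0 qc lt_q.
have k2 : a * (1 + H * q') <= H * (1 + s).
  by move: k'; rewrite mulrAC ler_pdivrMr//; lra.
by rewrite -(ler_pM2l H0); nra.
Qed.

(** The lower half of right-continuity in the price; the upper half is [kkt_le]. *)
Lemma kkt_cvg c a b H q e : 0 <= a -> 0 <= b -> 0 < H -> 0 < e ->
  kkt c a H q ->
  exists2 t0, 0 < t0 &
    forall t q', 0 <= t -> t < t0 -> kkt c (a + t * b) H q' -> q - e < q'.
Proof.
move=> a0 b0 H0 e0 K; have [q0 qc _] := K.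
have [qe|qe] := ltP q e.
  by exists 1 => // t q' _ _ [q'0 _ _]; lra.
(* [d] is the numerator of the derivative at [q - e]. *)
set d := H - a * (1 + H * (q - e)).
have d0 : 0 < d.
  have k : a * (1 + H * q) <= H.
    apply: (kkt_gt K (lexx 0)); last lra.
    by apply: le_trans qc; rewrite lee_fin.
  rewrite /d; have [a_gt0|] := ltP 0 a; last first.
    by move=> a_le0; have -> : a = 0; [apply/le_anti/andP|rewrite mul0r subr0].
  by have := mulr_gt0 (mulr_gt0 a_gt0 H0) e0; nra.
have m0 : 0 <= b * (1 + H * q) by apply: mulr_ge0 => //; nra.
(* Raising the price by [t * b] lowers [d] by at most [t * (b * (1 + H * q))]; the added [1] covers
   [b = 0]. *)
exists (d / (1 + b * (1 + H * q))); first by rewrite divr_gt0//; lra.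
move=> t q' t0; rewrite ltr_pdivlMr; last lra.
move=> td K'; have [q'0 q'c _] := K'; rewrite ltNge; apply/negP => q'q.
have k' : H <= (a + t * b) * (1 + H * q') by apply: (kkt_lt K' q0 qc); lra.
rewrite /d in td *.
have ha : a * (1 + H * q') <= a * (1 + H * (q - e)).
  by apply: ler_wpM2l => //; rewrite lerD2l; apply: ler_wpM2l => //; exact: ltW.
have hb : t * (b * (1 + H * q')) <= t * (b * (1 + H * q)).
  apply: ler_wpM2l => //; apply: ler_wpM2l => //; rewrite lerD2l; apply: ler_wpM2l; lra.
nra.
Qed.

End kkt_theory.

(** * Best user, price, cap and power rule at a single channel state *)

Section power_rule.
Context {R : realType} {K M : nat}.
Implicit Types (hs : 'I_K -> R) (fs mu : 'I_M -> R) (lam : R).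

Definition maxgain hs : R := \big[Order.max/0]_(k < K) hs k.

(** Ties are broken by the smallest index, so that no two users are served at once. *)
Definition best hs k : bool :=
  (hs k == maxgain hs) && [forall j : 'I_K, (j < k)%N ==> (hs j != maxgain hs)].

Definition good hs fs : bool :=
  [forall k, 0 < hs k] && [forall m, 0 < fs m].

(** A policy must be nonnegative at every argument, even at negative gains; the guard [good]
    confines the formula to positive gains, which occur almost surely. *)
Definition single (q : ('I_K -> R) -> ('I_M -> R) -> R) : policy R K M :=
  fun hs fs k => if good hs fs && best hs k then q hs fs else 0.

Definition slope lam mu fs : R := lam + \sum_(m < M) mu m * fs m.

Definition cap (ltQ ltG : bool) (QST : R) (GST fs : 'I_M -> R) : \bar R :=
  Order.min (if ltQ then +oo%E else QST%:E)
            (if ltG then +oo%E else min_ratio GST fs).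

(** [fine] would return [0] at an infinite minimum; [fill_kkt] excludes that case. *)
Definition fill (c : ('I_M -> R) -> \bar R) lam mu hs fs : R :=
  fine (Order.min (c fs) (epos (einv (slope lam mu fs) - einv (maxgain hs))%E)).

Lemma maxgain_ge hs k : hs k <= maxgain hs.
Proof. exact: le_bigmax. Qed.

Lemma best_exists hs : (0 < K)%N -> (forall k, 0 <= hs k) -> exists k, best hs k.
Proof.
move=> K0 h0.
have [i _ hi] := @eq_bigmax _ _ _ 0 (Ordinal K0) xpredT hs isT (fun k _ => h0 k).
have Pi : hs i == maxgain hs by rewrite /maxgain hi.
case: (@arg_minnP _ i (fun k => hs k == maxgain hs) (fun k : 'I_K => k : nat) Pi).
move=> k hk kmin.
exists k; rewrite /best hk; apply/forallP => j; apply/implyP; apply: contraL => hj.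
by rewrite -leqNgt kmin.
Qed.

Lemma best_unique hs j k : best hs j -> best hs k -> j = k.
Proof.
move=> /andP[hj /forallP mj] /andP[hk /forallP mk]; apply/val_inj.
case: (ltngtP j k) => // lt.
  by have := implyP (mk _) lt; rewrite hj.
by have := implyP (mj _) lt; rewrite hk.
Qed.

Lemma best_max hs k : best hs k -> hs k = maxgain hs.
Proof. by case/andP => /eqP. Qed.

Lemma maxgain_gt0 hs fs : (0 < K)%N -> good hs fs -> 0 < maxgain hs.
Proof.
move=> K0 /andP[/forallP h0 _].
exact: lt_le_trans (h0 (Ordinal K0)) (maxgain_ge _ _).
Qed.

Lemma slope_ge0 lam mu fs : 0 <= lam -> (forall m, 0 <= mu m) ->
  (forall m, 0 <= fs m) -> 0 <= slope lam mu fs.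
Proof.
by move=> l0 m0 f0; rewrite addr_ge0// sumr_ge0// => m _; rewrite mulr_ge0.
Qed.

Lemma slopeD lam mu lam' mu' t fs :
  slope (lam + t * lam') (fun m => mu m + t * mu' m) fs =
  slope lam mu fs + t * slope lam' mu' fs.
Proof.
rewrite /slope mulrDr addrACA mulr_sumr -big_split/=; congr (_ + _).
by apply: eq_bigr => m _; rewrite mulrDl mulrA.
Qed.

Lemma slope_scale lam mu s fs :
  slope (lam / s) (fun m => mu m / s) fs = slope lam mu fs / s.
Proof.
rewrite /slope mulrDl mulr_suml; congr (_ + _).
by apply: eq_bigr => m _; rewrite mulrAC.
Qed.

Lemma le_min_ratio GST fs s : (forall m, 0 <= fs m) -> (forall m, 0 < GST m) ->
  (s%:E <= min_ratio GST fs)%E <-> (forall m, fs m * s <= GST m).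
Proof.
move=> f0 G0; have fE m : (s%:E <= if fs m == 0%R then +oo else (GST m / fs m)%:E)%E
    = (fs m * s <= GST m).
  have [->|fN0] := eqVneq (fs m) 0; first by rewrite leey mul0r ltW.
  by rewrite lee_fin ler_pdivlMr 1?mulrC// lt_neqAle eq_sym fN0 f0.
split=> [/bigmin_geP[_ sG] m|sG]; first by rewrite -fE sG.
by apply/bigmin_geP; split=> [|m _]; [exact: leey|rewrite fE].
Qed.

Lemma le_cap ltQ ltG QST GST fs s :
  (forall m, 0 <= fs m) -> (forall m, 0 < GST m) ->
  (s%:E <= cap ltQ ltG QST GST fs)%E <->
  (~~ ltQ -> s <= QST) /\ (~~ ltG -> forall m, fs m * s <= GST m).
Proof.
move=> f0 G0; rewrite /cap le_min; split=> [/andP[sQ sG]|[sQ sG]].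
  split; first by case: ltQ sQ.
  by case: ltG sG => // /(le_min_ratio _ f0 G0).
apply/andP; split.
  by case: ltQ sQ => [|sQ]; [rewrite leey|rewrite lee_fin; exact: sQ].
by case: ltG sG => [|sG]; [rewrite leey|apply/(le_min_ratio _ f0 G0); exact: sG].
Qed.

Lemma cap_ge0 ltQ ltG QST GST fs : (forall m, 0 <= fs m) -> 0 < QST ->
  (forall m, 0 < GST m) -> (0 <= cap ltQ ltG QST GST fs)%E.
Proof.
move=> f0 Q0 G0; apply/(le_cap _ _ _ 0 f0 G0).
by split=> [_|_ m]; rewrite ?mulr0 ltW.
Qed.

Lemma fill_kkt c lam mu hs fs : (0 < K)%N -> good hs fs -> 0 <= lam ->
  (forall m, 0 <= mu m) -> (0 <= c fs)%E ->
  (c fs = +oo%E -> 0 < slope lam mu fs) ->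
  kkt (c fs) (slope lam mu fs) (maxgain hs) (fill c lam mu hs fs) /\
  (fill c lam mu hs fs)%:E =
    Order.min (c fs) (epos (einv (slope lam mu fs) - einv (maxgain hs))%E).
Proof.
move=> K0 hg l0 m0 c0 ca.
have f0 m : 0 <= fs m by case/andP: hg => _ /forallP/(_ m)/ltW.
have [q qE] := waterfill_kkt (slope_ge0 l0 m0 f0) (maxgain_gt0 K0 hg) c0 ca.
by rewrite /fill qE.
Qed.

End power_rule.

(** * Measurability of inverses, finite conjunctions and finite extrema *)

Section measurability.
Context {R : realType} {d : measure_display} {T : measurableType d}.

(** The measurable power function of exponent [-1] agrees with the inverse on nonnegative numbers,
    [0] included. *)
Lemma measurable_inv_ge0 (g : T -> R) : (forall x, 0 <= g x) ->
  measurable_fun setT g -> measurable_fun setT (fun x => (g x)^-1).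
Proof.
move=> g0 mg.
rewrite (_ : (fun _ => _) = (fun y => y `^ (-1)) \o g); last first.
  by apply/funext => x /=; rewrite powR_inv1.
exact: measurableT_comp (measurable_powR _) mg.
Qed.

Lemma measurable_einv (g : T -> R) : (forall x, 0 <= g x) ->
  measurable_fun setT g -> measurable_fun setT (fun x => einv (g x)).
Proof.
move=> g0 mg; apply: measurable_fun_ifT => //.
  exact: measurable_fun_eqr.
by apply/measurable_EFinP; exact: measurable_inv_ge0.
Qed.

Lemma measurable_forall (I : finType) (b : I -> T -> bool) :
  (forall i, measurable_fun setT (b i)) ->
  measurable_fun setT (fun x => [forall i, b i x]).
Proof.
move=> mb; apply: (measurable_fun_bool true); rewrite setTI.
rewrite (_ : _ @^-1` _ = \bigcap_(i in [set: I]) (b i @^-1` [set true])).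
  by apply: fin_bigcap_measurable => // i _; rewrite -[X in measurable X]setTI; exact: mb.
apply/seteqP; split=> x /=; first by move=> /forallP bx i _; exact: bx.
by move=> bx; apply/forallP => i; exact: bx.
Qed.

Lemma measurable_bigmax (I : Type) (s : seq I) (g : I -> T -> R) :
  (forall i, measurable_fun setT (g i)) ->
  measurable_fun setT (fun x => \big[Order.max/0]_(i <- s) g i x).
Proof.
move=> mg; elim: s => [|i s ih].
  by rewrite (_ : (fun _ => _) = cst 0)//; apply/funext => x; rewrite big_nil.
by under eq_fun do rewrite big_cons; apply: measurable_maxr.
Qed.

Lemma measurable_bigmine (I : Type) (s : seq I) (g : I -> T -> \bar R) :
  (forall i, measurable_fun setT (g i)) ->
  measurable_fun setT (fun x => \big[Order.min/+oo%E]_(i <- s) g i x).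
Proof.
move=> mg; elim: s => [|i s ih].
  by rewrite (_ : (fun _ => _) = cst +oo%E)//; apply/funext => x; rewrite big_nil.
by under eq_fun do rewrite big_cons; apply: measurable_mine.
Qed.

Lemma measurable_min_ratio M (GST : 'I_M -> R) (f : 'I_M -> T -> R) :
  (forall m x, 0 <= f m x) -> (forall m, measurable_fun setT (f m)) ->
  measurable_fun setT (fun x => min_ratio GST (fst_ f x)).
Proof.
move=> f0 mf; apply: measurable_bigmine => m; apply: measurable_fun_ifT => //.
  exact: measurable_fun_eqr (mf m) (measurable_cst _).
apply/measurable_EFinP; apply: measurable_funM => //.
exact: measurable_inv_ge0 (f0 m) (mf m).
Qed.

End measurability.
Section channel.
Context {R : realType} {d : measure_display} {T : measurableType d}.
Variables (P : probability T R) (K M : nat).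
Variables (h : 'I_K -> T -> R) (f : 'I_M -> T -> R).
Hypothesis K0 : (0 < K)%N.
Hypothesis mh : forall k, measurable_fun setT (h k).
Hypothesis mf : forall m, measurable_fun setT (f m).
Hypothesis h0 : forall k x, 0 <= h k x.
Hypothesis f0 : forall m x, 0 <= f m x.

(** * Almost sure positivity of the gains *)

Section positive_gains.

(** All gains form one family, indexed like the argument of [joint_cdf], so that both kinds are
    treated at once. *)
Let z (j : 'I_(K + M)) (x : T) : R :=
  match fintype.split j with inl k => h k x | inr m => f m x end.

Let z_ge0 j x : 0 <= z j x. Proof. by rewrite /z; case: fintype.split. Qed.

Let mz j : measurable_fun setT (z j).
Proof. by rewrite /z; case: fintype.split. Qed.

Let joint_cdfE v :
  joint_cdf P h f v = fine (P [set x | [forall j, z j x <= v ord0 j]]).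
Proof.
rewrite /joint_cdf; congr (fine (P _)); apply/seteqP; split=> x /=.
  move=> [vh vf]; apply/forallP => j; rewrite /z.
  by case: splitP => [k|m] jE; [have -> : j = lshift M k by exact/val_inj|
    have -> : j = rshift K m by exact/val_inj].
move=> /forallP vz; split=> [k|m].
  by have := vz (lshift M k); rewrite /z (unsplitK (inl k)).
by have := vz (rshift K m); rewrite /z (unsplitK (inr m)).
Qed.

Let measurable_orthant (v : 'rV[R]_(K + M)) :
  measurable [set x | [forall j, z j x <= v ord0 j]].
Proof.
have := @measurable_forall _ T _ (fun j x => z j x <= v ord0 j)
  (fun j => measurable_fun_ler (mz j) (measurable_cst _)).
by move=> /(_ measurableT [set true]); rewrite setTI; exact.
Qed.

(* The distribution function vanishes as soon as one coordinate is negative,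
   so by continuity it vanishes where one coordinate is zero. *)
Let z_gt0 j : continuous (joint_cdf P h f) -> {ae P, forall x, 0 < z j x}.
Proof.
move=> cF.
(* Level [e] for gain [j] and [n] for the others; the events [S n] then exhaust the event that gain
   [j] vanishes. *)
pose v n e : 'rV[R]_(K + M) := \row_i (if i == j then e else n%:R).
pose S n := [set x | [forall i, z i x <= v n 0 ord0 i]].
have Fneg n e : e < 0 -> joint_cdf P h f (v n e) = 0.
  move=> e0; rewrite joint_cdfE (_ : [set _ | _] = set0) ?measure0//.
  apply/seteqP; split=> x //= /forallP /(_ j); rewrite mxE eqxx.
  by move=> /(le_trans (z_ge0 j x)); rewrite leNgt e0.
have F0 n : joint_cdf P h f (v n 0) = 0.
  apply/eqP; rewrite -normr_le0; apply/ler_addgt0Pr => e e0; rewrite add0r.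
  have /cvgrPdist_lt /(_ e e0) := cF (v n 0).
  (* The level [- (r / 2)] is negative yet within [r] of [0]. *)
  rewrite near_simpl => /nbhs_ballP[r /= r0] /(_ (v n (- (r / 2)))).
  have r2 : 0 < r / 2 by rewrite divr_gt0.
  rewrite (Fneg n (- (r / 2))) ?oppr_lt0// subr0.
  move=> Fe; apply/ltW/Fe; split=> // i k; rewrite !mxE; case: ifP => _; last exact: ballxx.
  rewrite /ball/= sub0r opprK gtr0_norm//.
  by rewrite ltr_pdivrMr// mulr_natr mulr2n ltrDl.
have S0 n : P.-negligible (S n).
  apply/negligibleP; first exact: measurable_orthant.
  by have := F0 n; rewrite joint_cdfE => /eqP; rewrite fine_eq0 ?fin_num_measure// => /eqP.
apply: negligibleS (negligible_bigcup S0) => x /= /negP; rewrite -leNgt => zx.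
(* The sum of the nonnegative gains dominates each of them, so one integer above it serves all
   coordinates. *)
pose B := \sum_i z i x.
exists (Num.truncn B).+1 => //=; apply/forallP => i; rewrite mxE.
case: eqP => [->//|_]; apply: ltW; apply: le_lt_trans (truncnS_gt B).
by rewrite /B (bigD1 i)//= lerDl sumr_ge0.
Qed.

Lemma ae_good : continuous (joint_cdf P h f) ->
  {ae P, forall x, good (hst h x) (fst_ f x)}.
Proof.
move=> cF; have : {ae P, forall x, forall j, 0 < z j x}.
  by apply: filter_forall => j; exact: z_gt0.
apply: filterS => x zx; apply/andP; split; apply/forallP.
  by move=> k; have := zx (lshift M k); rewrite /z (unsplitK (inl k)).
by move=> m; have := zx (rshift K m); rewrite /z (unsplitK (inr m)).
Qed.

End positive_gains.

Lemma gain_ge0 x k : 0 <= hst h x k. Proof. exact: h0. Qed.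

Lemma interference_ge0 x m : 0 <= fst_ f x m. Proof. exact: f0. Qed.

Lemma measurable_maxgain : measurable_fun setT (fun x => maxgain (hst h x)).
Proof. exact: measurable_bigmax. Qed.

Lemma measurable_slope lam mu :
  measurable_fun setT (fun x => slope lam mu (fst_ f x)).
Proof.
apply: measurable_funD => //; apply: measurable_sum => m.
exact: measurable_funM (measurable_cst _) (mf m).
Qed.

(** * Policies that serve one best user *)

Section single_user.
Variable q : ('I_K -> R) -> ('I_M -> R) -> R.

Lemma single_at x : good (hst h x) (fst_ f x) -> exists i : 'I_K,
  [/\ forall k, h k x <= h i x, h i x = maxgain (hst h x),
      forall k, k != i -> pw h f (single q) x k = 0 &
      pw h f (single q) x i = q (hst h x) (fst_ f x)].
Proof.
move=> gx; have [i bi] := best_exists K0 (gain_ge0 x).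
exists i; have iH := best_max bi; split=> //.
- by move=> k; rewrite -[h i x]/(hst h x i) iH; exact: maxgain_ge.
- move=> k ki; rewrite /pw /single gx /=; case: ifPn => // bk.
  by rewrite (best_unique bk bi) eqxx in ki.
- by rewrite /pw /single gx bi.
Qed.

Lemma pw_single_bad x k : ~~ good (hst h x) (fst_ f x) -> pw h f (single q) x k = 0.
Proof. by rewrite /pw /single => /negbTE ->. Qed.

Lemma tpow_single x : tpow h f (single q) x =
  if good (hst h x) (fst_ f x) then q (hst h x) (fst_ f x) else 0.
Proof.
case: ifPn => [/single_at[i [_ _ pk pi]]|bad]; last first.
  by rewrite /tpow big1// => k _; rewrite pw_single_bad.
by rewrite /tpow (bigD1 i)//= big1 ?addr0.
Qed.

Lemma rate_single x : rate h f (single q) x =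
  if good (hst h x) (fst_ f x)
  then ln (1 + maxgain (hst h x) * q (hst h x) (fst_ f x)) else 0.
Proof.
rewrite /rate; case: ifPn => [/single_at[i [_ hi pk pi]]|bad]; last first.
  by rewrite big1 ?addr0 ?ln1// => k _; rewrite pw_single_bad ?mulr0.
by rewrite (bigD1 i)//= big1 ?addr0 ?pi ?hi// => k ki; rewrite pk ?mulr0.
Qed.

Lemma basic_single : measurable_fun setT (fun x => q (hst h x) (fst_ f x)) ->
  (forall hs fs, good hs fs -> 0 <= q hs fs) -> basic_policy h f (single q).
Proof.
move=> mq q0; split=> [k|hs fs k]; last first.
  by rewrite /single; case: ifPn => // /andP[/q0].
apply: measurable_fun_ifT => //; apply: measurable_and; first apply: measurable_and.
- apply: measurable_forall => j.
  exact: measurable_fun_ltr (measurable_cst _) (mh j).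
- apply: measurable_forall => m.
  exact: measurable_fun_ltr (measurable_cst _) (mf m).
- have me j : measurable_fun setT (fun x => hst h x j == maxgain (hst h x)).
    exact: measurable_fun_eqr (mh j) measurable_maxgain.
  apply: measurable_and => //; apply: measurable_forall => j.
  case: (j < k)%N => /=; last exact: measurable_cst.
  exact: measurable_neg.
Qed.

End single_user.

(** * Nonnegativity, measurability and expected cost of a policy *)

Section policy_measurability.
Variable p : policy R K M.
Hypothesis bp : basic_policy h f p.

Lemma pw_ge0 x k : 0 <= pw h f p x k. Proof. exact: bp.2. Qed.

Lemma tpow_ge0 x : 0 <= tpow h f p x.
Proof. by apply: sumr_ge0 => k _; exact: pw_ge0. Qed.

Lemma received_ge0 x : 0 <= \sum_(k < K) h k x * pw h f p x k.
Proof. by apply: sumr_ge0 => k _; rewrite mulr_ge0// pw_ge0. Qed.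

Lemma rate_ge0 x : 0 <= rate h f p x.
Proof. by rewrite ln_ge0// lerDl received_ge0. Qed.

Lemma measurable_tpow : measurable_fun setT (tpow h f p).
Proof. by apply: measurable_sum => k; exact: bp.1. Qed.

Lemma measurable_rate : measurable_fun setT (rate h f p).
Proof.
apply: measurableT_comp (@measurable_ln R) _; apply: measurable_funD => //.
apply: measurable_sum => k; apply: measurable_funM => //; exact: bp.1.
Qed.

Lemma Obj_ge0 : (0 <= Obj P h f p)%E.
Proof. by apply: integral_ge0 => x _; rewrite lee_fin rate_ge0. Qed.

Lemma Eq_ge0 : (0 <= Eq P h f p)%E.
Proof. by apply: integral_ge0 => x _; rewrite lee_fin tpow_ge0. Qed.

Lemma Efq_ge0 m : (0 <= Efq P h f p m)%E.
Proof. by apply: integral_ge0 => x _; rewrite lee_fin mulr_ge0// tpow_ge0. Qed.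

End policy_measurability.

(** Kept as one integral, so that a pointwise bound on the cost makes it finite without separate
    bounds on the long-term averages. *)
Definition Eprice lam mu (p : policy R K M) : \bar R :=
  (\int[P]_x (slope lam mu (fst_ f x) * tpow h f p x)%:E)%E.

Lemma measurable_price lam mu p : basic_policy h f p ->
  measurable_fun setT (fun x => (slope lam mu (fst_ f x) * tpow h f p x)%:E).
Proof.
move=> bp; apply/measurable_EFinP; apply: measurable_funM.
  exact: measurable_slope.
exact: measurable_tpow.
Qed.

Lemma price_ge0 lam mu p x : 0 <= lam -> (forall m, 0 <= mu m) ->
  basic_policy h f p -> 0 <= slope lam mu (fst_ f x) * tpow h f p x.
Proof.
by move=> l0 m0 bp; rewrite mulr_ge0 ?tpow_ge0// slope_ge0// => m; exact: f0.
Qed.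

Lemma EpriceE lam mu p : 0 <= lam -> (forall m, 0 <= mu m) -> basic_policy h f p ->
  Eprice lam mu p =
    (lam%:E * Eq P h f p + \sum_(m < M) (mu m)%:E * Efq P h f p m)%E.
Proof.
move=> l0 m0 bp.
have mt := measurable_tpow bp; have t0 := tpow_ge0 bp.
have mft m : measurable_fun setT (fun x => (f m x * tpow h f p x)%:E).
  by apply/measurable_EFinP; exact: measurable_funM.
have mtE : measurable_fun setT (fun x => (tpow h f p x)%:E) by apply/measurable_EFinP.
rewrite /Eq -ge0_integralZl_EFin//; last by move=> x _; rewrite lee_fin.
have fq m : ((mu m)%:E * Efq P h f p m =
    \int[P]_x ((mu m)%:E * (f m x * tpow h f p x)%:E))%E.
  by rewrite /Efq -ge0_integralZl_EFin// => x _; rewrite lee_fin mulr_ge0.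
under eq_bigr do rewrite fq.
rewrite -ge0_integral_sum//; last 2 first.
- by move=> m; apply: emeasurable_funM.
- by move=> m x _; rewrite mule_ge0// lee_fin ?mulr_ge0.
rewrite -ge0_integralD//; last 4 first.
- by move=> x _; rewrite mule_ge0// lee_fin.
- by apply: emeasurable_funM.
- by move=> x _; apply: sume_ge0 => m _; rewrite mule_ge0// lee_fin ?mulr_ge0.
- by apply: emeasurable_sum => m; apply: emeasurable_funM.
apply: eq_integral => x _; rewrite /slope mulrDl EFinD EFinM mulr_suml.
congr (_ + _)%E; rewrite -sumEFin.
by apply: eq_bigr => m _; rewrite -EFinM mulrA.
Qed.

(** * The Lagrangian and its maximisation by water-filling *)

Section constraints.
Variables (ltQ ltG : bool) (QLT QST : R) (GLT GST : 'I_M -> R).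
Hypothesis QST0 : 0 < QST.
Hypothesis GST0 : forall m, 0 < GST m.
Hypothesis aeg : {ae P, forall x, good (hst h x) (fst_ f x)}.

Let c : ('I_M -> R) -> \bar R := cap ltQ ltG QST GST.
Let dom := dual_domain h f ltQ ltG QST GST.
Let g := dual_fun P h f ltQ ltG QLT QST GLT GST.
Let L := lagrangian P h f ltQ ltG QLT GLT.

Definition budget lam (mu : 'I_M -> R) : R := lam * QLT + \sum_(m < M) mu m * GLT m.

(* The multiplier of a constraint that is not dualised is set to [0], so that
   [slope] is the total price of power in each of the four cases. *)
Definition multipliers (lam : R) (mu : 'I_M -> R) : Prop :=
  [/\ 0 <= lam, forall m, 0 <= mu m, ~~ ltQ -> lam = 0 &
      ~~ ltG -> forall m, mu m = 0].

(* Power is either peak-limited or has a positive price; otherwise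
   water-filling would ask for infinite power. *)
Definition proper lam mu : Prop := forall x,
  good (hst h x) (fst_ f x) -> c (fst_ f x) = +oo%E -> 0 < slope lam mu (fst_ f x).

Lemma lagrangianE lam mu p : multipliers lam mu -> basic_policy h f p ->
  L lam mu p = (Obj P h f p - (Eprice lam mu p - (budget lam mu)%:E))%E.
Proof.
move=> [l0 m0 lQ mG] bp; rewrite /L /lagrangian EpriceE// /budget.
have -> : (if ltQ then lam%:E * (Eq P h f p - QLT%:E) else 0)%E =
    (lam%:E * Eq P h f p - (lam * QLT)%:E)%E.
  case: ltQ lQ => [_|->//]; last by rewrite mul0e mul0r sube0.
  by rewrite muleBr// fin_num_adde_defl.
have -> : (if ltG then \sum_(m < M) (mu m)%:E * (Efq P h f p m - (GLT m)%:E) else 0)%E =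
    (\sum_(m < M) (mu m)%:E * Efq P h f p m - (\sum_(m < M) mu m * GLT m)%:E)%E.
  case: ltG mG => [_|mG]; last first.
    rewrite big1 => [|m _]; last by rewrite mG// mul0e.
    by rewrite big1 ?sube0// => m _; rewrite mG// mul0r.
  rewrite -sumEFin -sumeN; last by move=> i j _ _; rewrite fin_num_adde_defl.
  rewrite -big_split/=; apply: eq_bigr => m _.
  by rewrite muleDr ?fin_num_adde_defl// -EFinM mulrN.
(* None of the three terms can be [-oo], which makes the rearrangement valid in the extended
   reals. *)
have : (0 <= lam%:E * Eq P h f p)%E by rewrite mule_ge0 ?lee_fin// Eq_ge0.
have : (0 <= \sum_(m < M) (mu m)%:E * Efq P h f p m)%E.
  by apply: sume_ge0 => m _; rewrite mule_ge0 ?lee_fin// Efq_ge0.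
have := Obj_ge0 bp.
move: (Obj _ _ _ _) (_ * _)%E (\sum_(m < M) (mu m)%:E * _)%E.
move=> [w| |] [u| |] [v| |] //= _ _ _.
by rewrite -!EFinD; congr (_%:E); ring.
Qed.

Lemma domain_cap p x : dom p -> ((tpow h f p x)%:E <= c (fst_ f x))%E.
Proof.
move=> [bp [pQ pG]]; apply/(le_cap _ _ _ _ (interference_ge0 x) GST0).
split=> [nQ|nG m]; first exact: pQ.
exact: pG.
Qed.

Lemma feasible_domain p : feasible P h f ltQ ltG QLT QST GLT GST p -> dom p.
Proof.
by move=> [bp [pQ pG]]; split=> //; split=> [nQ|nG]; [case: ltQ nQ pQ|case: ltG nG pG].
Qed.

Lemma cap_fst_ge0 x : (0 <= c (fst_ f x))%E.
Proof. by apply: cap_ge0 => // m; exact: f0. Qed.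

Let wf lam mu : policy R K M := single (fill c lam mu).

Lemma basic_fill lam mu : multipliers lam mu -> basic_policy h f (wf lam mu).
Proof.
move=> [l0 m0 _ _]; apply: basic_single; last first.
  move=> hs fs /andP[_ /forallP fs0]; rewrite /fill fine_ge0// le_min.
  rewrite cap_ge0//; last by move=> m; exact: ltW.
  by rewrite /epos le_max lexx orbT.
apply: (measurableT_comp (fine_measurable measurableT)).
apply: measurable_mine.
  apply: measurable_mine => //.
  by case: ltG => //; exact: measurable_min_ratio.
apply: measurable_maxe => //; apply: emeasurable_funB.
  apply: measurable_einv; last exact: measurable_slope.
  by move=> x; apply: slope_ge0 => // m; exact: f0.
apply: measurable_einv; last exact: measurable_maxgain.
by move=> x; apply: bigmax_ge_id.
Qed.

Lemma fill_at lam mu x : multipliers lam mu -> proper lam mu ->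
  good (hst h x) (fst_ f x) ->
  kkt (c (fst_ f x)) (slope lam mu (fst_ f x)) (maxgain (hst h x))
    (tpow h f (wf lam mu) x).
Proof.
move=> [l0 m0 _ _] pr gx; rewrite tpow_single gx.
by apply: (fill_kkt K0 gx l0 m0 (cap_fst_ge0 x) _).1 => /pr -> .
Qed.

Lemma fill_domain lam mu : multipliers lam mu -> proper lam mu -> dom (wf lam mu).
Proof.
move=> ml pr; split; first exact: basic_fill.
have tc x : ((tpow h f (wf lam mu) x)%:E <= c (fst_ f x))%E.
  case gx : (good (hst h x) (fst_ f x)); first by case: (fill_at ml pr gx).
  by rewrite tpow_single gx cap_fst_ge0.
split=> [nQ x|nG m x].
  by have /(le_cap _ _ _ _ (interference_ge0 x) GST0)[/(_ nQ)] := tc x.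
by have /(le_cap _ _ _ _ (interference_ge0 x) GST0)[_ /(_ nG m)] := tc x.
Qed.

(** [kkt_opt] integrated over the good states. Each cost is moved to the opposite side, so that only
    sums of nonnegative integrals occur, finite or not. *)
Lemma fill_opt lam mu p : multipliers lam mu -> proper lam mu -> dom p ->
  (Obj P h f p + Eprice lam mu (wf lam mu) <=
   Obj P h f (wf lam mu) + Eprice lam mu p)%E.
Proof.
move=> ml pr dp; have [bp _] := dp; have bw := basic_fill ml.
have [l0 m0 _ _] := ml.
have mr q : basic_policy h f q -> measurable_fun setT (fun x => (rate h f q x)%:E).
  by move=> bq; apply/measurable_EFinP; exact: measurable_rate.
have r0 q x : basic_policy h f q -> (0 <= (rate h f q x)%:E)%E.
  by move=> bq; rewrite lee_fin rate_ge0.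
have s0 q x : basic_policy h f q ->
    (0 <= (slope lam mu (fst_ f x) * tpow h f q x)%:E)%E.
  by move=> bq; rewrite lee_fin price_ge0.
have mp q : basic_policy h f q -> measurable_fun setT
    (fun x => (slope lam mu (fst_ f x) * tpow h f q x)%:E) := @measurable_price lam mu q.
rewrite /Obj /Eprice -!ge0_integralD//;
  try by [move=> x _; exact: r0|move=> x _; exact: s0|exact: mr|exact: mp].
apply: ae_ge0_le_integral => //.
- by move=> x _; rewrite adde_ge0 ?r0 ?s0.
- by apply: emeasurable_funD; [exact: mr|exact: mp].
- by move=> x _; rewrite adde_ge0 ?r0 ?s0.
- by apply: emeasurable_funD; [exact: mr|exact: mp].
apply: filterS aeg => x gx _.
rewrite -!EFinD lee_fin.
have kx := fill_at ml pr gx.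
rewrite rate_single gx.
have -> : fill c lam mu (hst h x) (fst_ f x) = tpow h f (wf lam mu) x.
  by rewrite tpow_single gx.
apply: kkt_opt kx _ _ _ _.
- by apply: slope_ge0 => // m; exact: f0.
- exact: maxgain_gt0 gx.
- exact: tpow_ge0.
- exact: domain_cap.
- exact: received_ge0.
rewrite /tpow mulr_sumr; apply: ler_sum => k _; apply: ler_wpM2r; first exact: pw_ge0.
exact: (maxgain_ge (hst h x) k).
Qed.

Lemma Eprice_bounded lam mu p (B : R) : 0 <= lam -> (forall m, 0 <= mu m) ->
  basic_policy h f p ->
  (forall x, slope lam mu (fst_ f x) * tpow h f p x <= B) ->
  exists2 e, Eprice lam mu p = e%:E & e <= B.
Proof.
move=> l0 m0 bp pB.
have EB : (Eprice lam mu p <= B%:E)%E.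
  have -> : B%:E = (\int[P]_x (cst B%:E) x)%E.
    by rewrite integral_cst//= probability_setT mule1.
  apply: ge0_le_integral => //.
  - by move=> x _; rewrite lee_fin price_ge0.
  - exact: measurable_price.
  - by move=> x _; rewrite lee_fin pB.
have E0 : (0 <= Eprice lam mu p)%E.
  by apply: integral_ge0 => x _; rewrite lee_fin price_ge0.
case: (Eprice lam mu p) EB E0 => // e; rewrite lee_fin => eB _.
by exists e.
Qed.

Lemma fill_price_le1 lam mu x : multipliers lam mu -> proper lam mu ->
  slope lam mu (fst_ f x) * tpow h f (wf lam mu) x <= 1.
Proof.
move=> ml pr; have [l0 m0 _ _] := ml.
case gx : (good (hst h x) (fst_ f x)); last by rewrite tpow_single gx mulr0.
apply: kkt_price_le1 (cap_fst_ge0 x) (fill_at ml pr gx).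
  exact: slope_ge0 (interference_ge0 x).
exact: maxgain_gt0 gx.
Qed.

Lemma lagrangian_le_dual lam mu p : dom p -> (L lam mu p <= g lam mu)%E.
Proof. by move=> dp; apply: ereal_sup_ubound; exists p. Qed.

Lemma dual_fun_fill lam mu : multipliers lam mu -> proper lam mu ->
  (g lam mu <= L lam mu (wf lam mu))%E.
Proof.
move=> ml pr; apply: ge_ereal_sup => _ [p dp <-].
have [bp _] := dp; have bw := basic_fill ml; have [l0 m0 _ _] := ml.
rewrite -/(L lam mu p) !lagrangianE//.
have := fill_opt ml pr dp.
have [e -> _] := Eprice_bounded l0 m0 bw (fun x => fill_price_le1 x ml pr).
have := Obj_ge0 bw; have := Obj_ge0 bp.
have : (0 <= Eprice lam mu p)%E.
  by apply: integral_ge0 => x _; rewrite lee_fin price_ge0.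
move: (Obj P h f p) (Obj P h f (wf lam mu)) (Eprice lam mu p).
move=> [w| |] [u| |] [v| |] //= _ _ _; rewrite ?leey ?leNye//.
by rewrite -!EFinD !lee_fin; lra.
Qed.

(** At finite cost an infinite objective would make the Lagrangian infinite, above the dual
    value. *)
Lemma Obj_fin lam mu p e : multipliers lam mu -> (g lam mu < +oo)%E -> dom p ->
  Eprice lam mu p = e%:E -> exists w, Obj P h f p = w%:E.
Proof.
move=> ml gfin dp pe; have [bp _] := dp.
have := le_lt_trans (lagrangian_le_dual lam mu dp) gfin.
rewrite lagrangianE// pe; have := Obj_ge0 bp.
by case: (Obj P h f p) => [w| |] // _ _; exists w.
Qed.

(* Multipliers without price would leave the power unlimited: the policy
   [r / max_k h_k] gains [ln (1 + r)] at no cost. *)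
Lemma dual_fin_proper lam mu : multipliers lam mu -> (g lam mu < +oo)%E ->
  proper lam mu.
Proof.
move=> ml gfin x gx cx; have [l0 m0 lQ mG] := ml.
have fx m : 0 < f m x by case/andP: gx => _ /forallP/(_ m).
rewrite lt_neqAle (slope_ge0 l0 m0 (interference_ge0 x)) andbT eq_sym.
apply/negP => /eqP; rewrite /slope => /eqP.
rewrite paddr_eq0//; last by apply: sumr_ge0 => m _; exact: mulr_ge0 (m0 m) (ltW (fx m)).
rewrite psumr_eq0; last by move=> m _; exact: mulr_ge0 (m0 m) (ltW (fx m)).
move=> /andP[/eqP l_eq0 /allP mu_eq0].
have {}mu_eq0 m : mu m = 0.
  have /implyP/(_ isT) := mu_eq0 m (mem_index_enum _).
  by rewrite mulf_eq0 (gt_eqF (fx m)) orbF => /eqP.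
(* An infinite cap admits every power, whereas short-term limits would exclude [QST + 1] or
   [1 + GST m / f m x]; so every constraint present is long-term. *)
have capP s : (s%:E <= c (fst_ f x))%E by rewrite cx leey.
have LQ : ltQ.
  apply/negPn/negP => nQ.
  have /(le_cap _ _ _ _ (interference_ge0 x) GST0)[/(_ nQ) + _] := capP (QST + 1).
  lra.
have LG (m : 'I_M) : ltG.
  apply/negPn/negP => nG.
  have /(le_cap _ _ _ _ (interference_ge0 x) GST0)[_ /(_ nG m)] :=
    capP (1 + GST m / f m x).
  by rewrite /fst_ mulrDr mulrCA divff ?gt_eqF// !mulr1; have := fx m; lra.
have price0 p : basic_policy h f p -> Eprice lam mu p = 0%E.
  move=> bp; rewrite EpriceE// l_eq0 mul0e big1 ?adde0// => m _.
  by rewrite mu_eq0 mul0e.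
have budget0 : budget lam mu = 0.
  by rewrite /budget l_eq0 mul0r big1 ?addr0// => m _; rewrite mu_eq0 mul0r.
pose pr r : policy R K M := single (fun hs _ => r / maxgain hs).
have bpr r : 0 <= r -> basic_policy h f (pr r).
  move=> r0; apply: basic_single => [|hs fs ghf].
    apply: measurable_funM => //; apply: measurable_inv_ge0 measurable_maxgain.
    by move=> y; exact: bigmax_ge_id.
  by rewrite divr_ge0// ltW// (maxgain_gt0 K0 ghf).
have dpr r : 0 <= r -> dom (pr r).
  by move=> r0; split; [exact: bpr|split=> [|nG m]; [rewrite LQ|rewrite (LG m) in nG]].
have objr r : 0 <= r -> Obj P h f (pr r) = (ln (1 + r))%:E.
  move=> r0; have -> : (ln (1 + r))%:E = (\int[P]_y (cst (ln (1 + r))%:E) y)%E.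
    by rewrite integral_cst//= probability_setT mule1.
  apply: ae_eq_integral => //.
    by apply/measurable_EFinP; apply: measurable_rate; exact: bpr.
  apply: filterS aeg => y gy _ /=; congr (_%:E).
  rewrite rate_single gy mulrCA divff ?mulr1// gt_eqF//.
  exact: maxgain_gt0 gy.
have le_g r : 0 <= r -> ((ln (1 + r))%:E <= g lam mu)%E.
  move=> r0; rewrite -objr//; apply: le_trans (lagrangian_le_dual _ _ (dpr r r0)).
  have bp := bpr r r0.
  by rewrite lagrangianE// price0// budget0 !sube0.
have := le_g 0 (lexx _); rewrite addr0 ln1.
case: (g lam mu) gfin le_g => // B _ le_g; rewrite lee_fin => B0.
(* The choice [r = expR (B + 1) - 1] gains [B + 1], above the supposed dual value [B]. *)
have : 0 <= expR (B + 1) - 1 by rewrite subr_ge0 -expR0 ler_expR addr_ge0.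
by move=> /le_g; rewrite addrC subrK expRK lee_fin gerDl ler10.
Qed.

(** Water-filling at the primed price attains the primed dual value and competes in the unprimed
    one. The two Lagrangians share its objective, which is finite and cancels. *)
Lemma subgradient lam mu lam' mu' e e' :
  multipliers lam mu -> multipliers lam' mu' -> proper lam' mu' ->
  (g lam mu < +oo)%E -> (g lam mu <= g lam' mu')%E ->
  Eprice lam mu (wf lam' mu') = e%:E -> Eprice lam' mu' (wf lam' mu') = e'%:E ->
  budget lam mu - e <= budget lam' mu' - e'.
Proof.
move=> ml ml' pr' gfin gg pe pe'.
have dw := fill_domain ml' pr'; have bw := basic_fill ml'.
have [w Ow] := Obj_fin ml gfin dw pe.
have := le_trans (lagrangian_le_dual lam mu dw) (le_trans gg (dual_fun_fill ml' pr')).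
rewrite !lagrangianE// pe pe' Ow -!EFinB lee_fin; lra.
Qed.

(** * Water-filling at dual optimal multipliers *)

Section optimum.
Variables (lam : R) (mu : 'I_M -> R).
Hypothesis ml : multipliers lam mu.
Hypothesis opt : dual_optimal P h f ltQ ltG QLT QST GLT GST lam mu.
Hypothesis gfin : (dual_fun P h f ltQ ltG QLT QST GLT GST lam mu < +oo)%E.

Let pr : proper lam mu. Proof. exact: dual_fin_proper. Qed.

Lemma multipliersD lam2 mu2 t : multipliers lam2 mu2 -> 0 <= t ->
  multipliers (lam + t * lam2) (fun m => mu m + t * mu2 m).
Proof.
move=> [l0 m0 lQ mG] t0; have [l0' m0' lQ' mG'] := ml; split.
- by rewrite addr_ge0// mulr_ge0.
- by move=> m; rewrite addr_ge0// mulr_ge0.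
- by move=> nQ; rewrite lQ// lQ'// mulr0 addr0.
- by move=> nG m; rewrite mG// mG'// mulr0 addr0.
Qed.

Lemma properD lam2 mu2 t : multipliers lam2 mu2 -> 0 <= t ->
  proper (lam + t * lam2) (fun m => mu m + t * mu2 m).
Proof.
move=> [l0 m0 _ _] t0 x gx /(pr gx) s0; rewrite slopeD ltr_wpDr// mulr_ge0//.
exact: slope_ge0 (interference_ge0 x).
Qed.

Lemma budgetD lam2 mu2 t :
  budget (lam + t * lam2) (fun m => mu m + t * mu2 m) =
  budget lam mu + t * budget lam2 mu2.
Proof.
rewrite /budget mulrDr mulr_sumr addrACA -big_split/= mulrDl mulrA.
by congr (_ + _); apply: eq_bigr => m _; rewrite mulrDl mulrA.
Qed.

Lemma EpriceD lam2 mu2 t p : multipliers lam2 mu2 -> 0 <= t ->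
  basic_policy h f p ->
  Eprice (lam + t * lam2) (fun m => mu m + t * mu2 m) p =
  (Eprice lam mu p + t%:E * Eprice lam2 mu2 p)%E.
Proof.
move=> [l0 m0 _ _] t0 bp; have [l0' m0' _ _] := ml.
rewrite /Eprice -ge0_integralZl_EFin//; last 2 first.
- by move=> x _; rewrite lee_fin price_ge0.
- exact: measurable_price.
rewrite -ge0_integralD//; last 4 first.
- by move=> x _; rewrite lee_fin price_ge0.
- exact: measurable_price.
- by move=> x _; rewrite mule_ge0// lee_fin price_ge0.
- by apply: emeasurable_funM => //; exact: measurable_price.
by apply: eq_integral => x _; rewrite slopeD mulrDl EFinD -EFinM mulrA.
Qed.

(* Raising the price in an admissible direction does not decrease the dual
   function, so water-filling at the raised price respects the corresponding
   budget. *)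
Lemma perturbed_budget lam2 mu2 t : multipliers lam2 mu2 -> 0 < t ->
  (Eprice lam2 mu2 (wf (lam + t * lam2)%R (fun m => mu m + t * mu2 m)%R) <=
   (budget lam2 mu2)%:E)%E.
Proof.
move=> ml2 t0; have t0' := ltW t0.
have mlt := multipliersD ml2 t0'; have prt := properD ml2 t0'.
have bw := basic_fill mlt; have [l0 m0 _ _] := ml; have [l20 m20 _ _] := ml2.
have [lt0 mt0 _ _] := mlt.
set p := wf _ _ in bw *.
have le1 x : slope lam mu (fst_ f x) * tpow h f p x +
    t * (slope lam2 mu2 (fst_ f x) * tpow h f p x) <= 1.
  by have := fill_price_le1 x mlt prt; rewrite slopeD mulrDl mulrA.
(* Both costs are nonnegative and their combination with weight [t] is at most [1], so each is
   finite. *)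
have [e pe _] : exists2 e, Eprice lam mu p = e%:E & e <= 1.
  apply: Eprice_bounded => // x; apply: le_trans (le1 x).
  by rewrite lerDl mulr_ge0// price_ge0.
have [e2 pe2 _] : exists2 e, Eprice lam2 mu2 p = e%:E & e <= t^-1.
  apply: Eprice_bounded => // x; rewrite -[t^-1]mulr1 ler_pdivlMl//.
  by apply: le_trans (le1 x); rewrite lerDr price_ge0.
have pet : Eprice (lam + t * lam2) (fun m => mu m + t * mu2 m) p = (e + t * e2)%:E.
  by rewrite EpriceD// pe pe2 -EFinM -EFinD.
have gg := opt.2.2 _ _ lt0 mt0.
have := subgradient ml mlt prt gfin gg pe pet.
rewrite budgetD pe2 lee_fin -[e2 <= _](ler_pM2l t0); lra.
Qed.

(** Limit of [perturbed_budget] along [t n = 1 / (n + 1)]: the prices decrease, the powers increase,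
    and monotone convergence applies. Unit directions later recover the individual long-term
    constraints. *)
Lemma fill_budget lam2 mu2 : multipliers lam2 mu2 ->
  (Eprice lam2 mu2 (wf lam mu) <= (budget lam2 mu2)%:E)%E.
Proof.
move=> ml2; have [l0 m0 _ _] := ml; have [l20 m20 _ _] := ml2.
pose t n : R := n.+1%:R^-1.
have t0 n : 0 < t n by rewrite invr_gt0.
have t0' n := ltW (t0 n).
pose w n := wf (lam + t n * lam2) (fun m => mu m + t n * mu2 m).
have bw n : basic_policy h f (w n) by apply: basic_fill; exact: multipliersD.
pose u n x := (slope lam2 mu2 (fst_ f x) * tpow h f (w n) x)%:E.
have s2 x : 0 <= slope lam2 mu2 (fst_ f x) by exact: slope_ge0 (interference_ge0 x).
have s0 x : 0 <= slope lam mu (fst_ f x) by exact: slope_ge0 (interference_ge0 x).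
have wbad p x : ~~ good (hst h x) (fst_ f x) -> tpow h f (single p) x = 0.
  by rewrite tpow_single => /negbTE ->.
have kw n x : good (hst h x) (fst_ f x) ->
    kkt (c (fst_ f x)) (slope lam mu (fst_ f x) + t n * slope lam2 mu2 (fst_ f x))
      (maxgain (hst h x)) (tpow h f (w n) x).
  by move=> gx; rewrite -slopeD; apply: fill_at => //; [exact: multipliersD|exact: properD].
have nd x : {homo u^~ x : n m / (n <= m)%N >-> (n <= m)%E}.
  move=> n k nk; rewrite lee_fin ler_wpM2l//.
  have [gx|bx] := boolP (good (hst h x) (fst_ f x)); last by rewrite !wbad.
  apply: kkt_le (maxgain_gt0 K0 gx) (kw k x gx) (kw n x gx).
    by rewrite addr_ge0// mulr_ge0.
  by rewrite lerD2l ler_wpM2r// lef_pV2 ?posrE// ler_nat.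
(* The powers are squeezed between the bounds of [kkt_cvg] and [kkt_le]. *)
have lu x : limn (u^~ x) = (slope lam2 mu2 (fst_ f x) * tpow h f (wf lam mu) x)%:E.
  apply/cvg_lim => //; apply: cvg_EFin; first exact: nearW.
  apply: cvgM; first exact: cvg_cst.
  have [gx|bx] := boolP (good (hst h x) (fst_ f x)); last first.
    by rewrite wbad//; under eq_fun do rewrite wbad//; exact: cvg_cst.
  have k := fill_at ml pr gx; have H0 := maxgain_gt0 K0 gx.
  apply/cvgrPdist_lt => e e0.
  have [d0 d00 hd] := kkt_cvg (s0 x) (s2 x) H0 e0 k.
  have /cvgrPdist_lt /(_ _ d00) := @cvg_harmonic R.
  apply: filterS => n; rewrite sub0r normrN gtr0_norm ?t0// => tn.
  have le_q : tpow h f (w n) x <= tpow h f (wf lam mu) x.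
    by apply: kkt_le H0 k (kw n x gx) => //; rewrite lerDl mulr_ge0.
  rewrite ger0_norm ?subr_ge0//.
  by have := hd (t n) _ (t0' n) tn (kw n x gx); lra.
have mu_ n : measurable_fun setT (u n) by exact: measurable_price.
have u0 n x : setT x -> (0 <= u n x)%E by move=> _; rewrite lee_fin price_ge0.
rewrite /Eprice; under eq_integral do rewrite -lu.
rewrite monotone_convergence//.
apply: lime_le; last by apply: nearW => n; exact: perturbed_budget.
by apply: cvgP (cvg_monotone_convergence measurableT mu_ u0 (fun x _ => nd x)).
Qed.

(* Scaling all prices by [1 / (1 + s)] changes the cost of the water-filling
   power by at most [s], whence complementary slackness in summed form. *)
Lemma fill_slack : ((budget lam mu)%:E <= Eprice lam mu (wf lam mu))%E.
Proof.
have [l0 m0 lQ mG] := ml; have bw := basic_fill ml.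
have [e pe _] := Eprice_bounded l0 m0 bw (fun x => fill_price_le1 x ml pr).
rewrite pe lee_fin; apply/ler_addgt0Pr => s s0.
have s1 : 0 < 1 + s by lra.
have mls : multipliers (lam / (1 + s)) (fun m => mu m / (1 + s)).
  split; [by rewrite divr_ge0// ltW|by move=> m; rewrite divr_ge0// ltW| |].
  - by move=> nQ; rewrite lQ// mul0r.
  - by move=> nG m; rewrite mG// mul0r.
have prs : proper (lam / (1 + s)) (fun m => mu m / (1 + s)).
  by move=> x gx /(pr gx) ?; rewrite slope_scale divr_gt0.
have bws := basic_fill mls; have [ls0 ms0 _ _] := mls.
set p := wf _ _ in bws.
have ple x : slope lam mu (fst_ f x) * tpow h f p x <=
    slope lam mu (fst_ f x) * tpow h f (wf lam mu) x + s.
  have [gx|bx] := boolP (good (hst h x) (fst_ f x)); last first.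
    by rewrite !tpow_single (negbTE bx) mulr0 add0r ltW.
  apply: kkt_scale (maxgain_gt0 K0 gx) s0 (fill_at ml pr gx) _.
    exact: slope_ge0 (interference_ge0 x).
  by rewrite -slope_scale; exact: fill_at.
have [e' pe' _] : exists2 e', Eprice lam mu p = e'%:E & e' <= 1 + s.
  apply: Eprice_bounded => // x; apply: le_trans (ple x) _.
  by rewrite lerD2r fill_price_le1.
have e'e : e' <= e + s.
  rewrite -lee_fin EFinD -pe -pe' /Eprice.
  have -> : s%:E = (\int[P]_x (cst s%:E) x)%E.
    by rewrite integral_cst//= probability_setT mule1.
  rewrite -ge0_integralD//; last 3 first.
  - by move=> x _; rewrite lee_fin price_ge0.
  - exact: measurable_price.
  - by move=> x _; rewrite lee_fin ltW.
  apply: ge0_le_integral => //.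
  - by move=> x _; rewrite lee_fin price_ge0.
  - exact: measurable_price.
  - by apply: emeasurable_funD => //; exact: measurable_price.
  - by move=> x _; rewrite -EFinD lee_fin.
have pes : Eprice (lam / (1 + s)) (fun m => mu m / (1 + s)) p = (e' / (1 + s))%:E.
  rewrite (mulrC e') EFinM -pe' /Eprice -ge0_integralZl_EFin//; last 3 first.
  - by move=> x _; rewrite lee_fin price_ge0.
  - exact: measurable_price.
  - by rewrite invr_ge0 ltW.
  by apply: eq_integral => x _; rewrite slope_scale -EFinM; congr (_%:E); ring.
have := subgradient ml mls prs gfin (opt.2.2 _ _ ls0 ms0) pe' pes.
have -> : budget (lam / (1 + s)) (fun m => mu m / (1 + s)) = budget lam mu / (1 + s).
  rewrite /budget mulrDl mulr_suml mulrAC; congr (_ + _).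
  by apply: eq_bigr => m _; rewrite mulrAC.
rewrite -mulrBl => Hb.
(* Were this difference positive, dividing it by [1 + s] would strictly decrease it, against
   [Hb]. *)
suff : budget lam mu - e' <= 0 by lra.
rewrite leNgt; apply/negP => b0.
by move: Hb; rewrite ler_pdivlMr// -subr_ge0; nra.
Qed.

End optimum.

(** * Primal optimality and the single-user form *)

Section optimality.
Variables (lam : R) (mu : 'I_M -> R).
Hypothesis ml : multipliers lam mu.

Lemma feasible_price p : feasible P h f ltQ ltG QLT QST GLT GST p ->
  (Eprice lam mu p <= (budget lam mu)%:E)%E.
Proof.
move=> [bp [pQ pG]]; have [l0 m0 lQ mG] := ml.
rewrite EpriceE// /budget EFinD -sumEFin; apply: leeD.
  case: ltQ lQ pQ => [_ pQ|/(_ isT) -> _]; last by rewrite mul0e mul0r.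
  by rewrite EFinM lee_wpmul2l// lee_fin.
apply: lee_sum => m _; case: ltG mG pG => [_ pG|/(_ isT m) -> _]; last first.
  by rewrite mul0e mul0r.
by rewrite EFinM lee_wpmul2l// lee_fin.
Qed.

(** Weak duality: a feasible policy costs at most the budget, hence at most what water-filling
    costs, and this finite cost cancels in [fill_opt]. *)
Lemma fill_optimal : proper lam mu ->
  feasible P h f ltQ ltG QLT QST GLT GST (wf lam mu) ->
  ((budget lam mu)%:E <= Eprice lam mu (wf lam mu))%E ->
  optimal_policy P h f ltQ ltG QLT QST GLT GST (wf lam mu).
Proof.
move=> pr fw slack; split=> // p fp.
have [l0 m0 _ _] := ml; have bw := basic_fill ml.
have [e pe _] := Eprice_bounded l0 m0 bw (fun x => fill_price_le1 x ml pr).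
have := fill_opt ml pr (feasible_domain fp).
rewrite pe => /le_trans le_obj.
rewrite -(@leeD2rE _ e%:E)//; apply: le_obj; apply: leeD => //.
by apply: le_trans (feasible_price fp) _; rewrite -pe.
Qed.

Lemma fill_dtdma x : proper lam mu -> good (hst h x) (fst_ f x) ->
  dtdma_at h f (wf lam mu) (fun i => Order.min (c (fst_ f x))
    (epos (einv (slope lam mu (fst_ f x)) - einv (h i x))%E)) x.
Proof.
move=> pr gx; have [l0 m0 _ _] := ml.
have [i [hi iH pk pi]] := single_at (fill c lam mu) gx.
exists i; split=> //; split=> //; rewrite pi iH.
by apply: (fill_kkt K0 gx l0 m0 (cap_fst_ge0 x) _).2 => /pr -> .
Qed.

End optimality.

Lemma dual_fill_optimal lam mu : multipliers lam mu ->
  dual_optimal P h f ltQ ltG QLT QST GLT GST lam mu ->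
  (dual_fun P h f ltQ ltG QLT QST GLT GST lam mu < +oo)%E ->
  optimal_policy P h f ltQ ltG QLT QST GLT GST (wf lam mu) /\
  {ae P, forall x, dtdma_at h f (wf lam mu) (fun i => Order.min (c (fst_ f x))
    (epos (einv (slope lam mu (fst_ f x)) - einv (h i x))%E)) x}.
Proof.
move=> ml opt gfin; have pr := dual_fin_proper ml gfin.
have [bw [wQ wG]] := fill_domain ml pr.
split; last by apply: filterS aeg => x; exact: fill_dtdma.
apply: fill_optimal => //; last exact: fill_slack.
split=> //; split.
  case: (boolP ltQ) wQ => [LQ _|nQ]; last by apply.
  (* The price [1] on power alone turns [fill_budget] into the long-term power constraint. *)
  have ml1 : multipliers 1 (fun=> 0) by split=> //; rewrite LQ.
  have [l1 m1 _ _] := ml1.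
  have := fill_budget ml opt gfin ml1; rewrite EpriceE// /budget mul1e mul1r.
  rewrite big1 ?adde0 => [|m _]; last by rewrite mul0e.
  by rewrite big1 ?addr0// => m _; rewrite mul0r.
case: (boolP ltG) wG => [LG _ m|nG]; last by apply.
(* The unit price on receiver [m] alone gives its long-term interference constraint. *)
have mlm : multipliers 0 (fun j => (j == m)%:R) by split=> //; rewrite LG.
have [l1 m1 _ _] := mlm.
have := fill_budget ml opt gfin mlm; rewrite EpriceE// /budget mul0e add0e mul0r add0r.
rewrite (bigD1 m)//= eqxx mul1e big1 ?adde0 => [|j /negbTE ->]; last by rewrite mul0e.
by rewrite (bigD1 m)//= eqxx mul1r big1 ?addr0// => j /negbTE ->; rewrite mul0r.
Qed.

End constraints.
End channel.

(** * The four combinations of long-term and short-term constraints *)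

Theorem theorem4p1 (R : realType) (d : measure_display) (T : measurableType d)
  (P : probability T R) (K M : nat)
  (h : 'I_K -> T -> R) (f : 'I_M -> T -> R)
  (QLT QST : R) (GLT GST : 'I_M -> R) :
  (0 < K)%N ->
  (forall k, measurable_fun setT (h k)) ->
  (forall m, measurable_fun setT (f m)) ->
  (forall k x, 0 <= h k x) -> (forall m x, 0 <= f m x) ->
  indep_h_f P h f ->
  continuous (joint_cdf P h f) ->
  (forall v, differentiable (joint_cdf P h f) v) ->
  0 < QLT -> 0 < QST -> (forall m, 0 < GLT m) -> (forall m, 0 < GST m) ->
  (* Case I *)
  (forall (lam : R) (mu : 'I_M -> R),
     dual_optimal P h f true true QLT QST GLT GST lam mu ->
     (dual_fun P h f true true QLT QST GLT GST lam mu < +oo)%E ->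
     exists p, optimal_policy P h f true true QLT QST GLT GST p /\
       {ae P, forall x, dtdma_at h f p (fun i =>
            (epos (einv (lam + \sum_(m < M) mu m * f m x) - einv (h i x)))%E) x}) /\
  (* Case II *)
  (forall lam : R,
     dual_optimal P h f true false QLT QST GLT GST lam (fun _ : 'I_M => 0%R) ->
     (dual_fun P h f true false QLT QST GLT GST lam (fun _ : 'I_M => 0%R) < +oo)%E ->
     exists p, optimal_policy P h f true false QLT QST GLT GST p /\
       {ae P, forall x, dtdma_at h f p (fun i =>
            (Order.min (min_ratio GST (fun m => f m x))
                       (epos (einv lam - einv (h i x))))%E) x}) /\
  (* Case III *)
  (forall mu : 'I_M -> R,
     dual_optimal P h f false true QLT QST GLT GST 0 mu ->
     (dual_fun P h f false true QLT QST GLT GST 0 mu < +oo)%E ->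
     exists p, optimal_policy P h f false true QLT QST GLT GST p /\
       {ae P, forall x, dtdma_at h f p (fun i =>
            (Order.min QST%:E
               (epos (einv (\sum_(m < M) mu m * f m x) - einv (h i x))))%E) x}) /\
  (* Case IV *)
  (exists p, optimal_policy P h f false false QLT QST GLT GST p /\
       {ae P, forall x,
          dtdma_at h f p (fun _ => (Order.min QST%:E (min_ratio GST (fun m => f m x)))%E) x}).
Proof.
move=> K0 mh mf h0 f0 _ cF _ _ Q0 _ G0.
have aeg := ae_good mh mf h0 f0 cF.
have core ltQ ltG := @dual_fill_optimal _ _ _ P K M h f K0 mh mf h0 f0
  ltQ ltG QLT QST GLT GST Q0 G0 aeg.
split; [|split; [|split]].
- move=> lam mu opt gfin; have [l0 [m0 _]] := opt.
  have ml : multipliers true true lam mu by [].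
  have [popt pae] := core true true lam mu ml opt gfin.
  eexists; split; first exact: popt.
  apply: filterS pae => x [i [hi [pk pi]]]; exists i; split=> //; split=> //.
  by rewrite pi /cap !minye.
- move=> lam opt gfin; have [l0 [m0 _]] := opt.
  have ml : multipliers true false lam (fun _ : 'I_M => 0) by [].
  have [popt pae] := core true false lam _ ml opt gfin.
  eexists; split; first exact: popt.
  apply: filterS pae => x; rewrite /cap minye /slope big1 ?addr0// => m _.
  by rewrite mul0r.
- move=> mu opt gfin; have [l0 [m0 _]] := opt.
  have ml : multipliers false true 0 mu by [].
  have [popt pae] := core false true 0 mu ml opt gfin.
  eexists; split; first exact: popt.
  by apply: filterS pae => x; rewrite /cap miney /slope add0r.
(* In Case IV nothing is dualised: the price and the budget are [0], slackness is immediate, and the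
   cap is finite because it is at most [QST]. *)
- have ml : multipliers false false 0 (fun _ : 'I_M => 0 : R) by [].
  have slope0 x : slope 0 (fun _ : 'I_M => 0 : R) (fst_ f x) = 0.
    by rewrite /slope add0r big1// => m _; rewrite mul0r.
  have pr : proper h f false false QST GST 0 (fun _ : 'I_M => 0 : R).
    move=> x _ cx; have : (cap false false QST GST (fst_ f x) <= QST%:E)%E.
      by rewrite /cap ge_min lexx.
    by rewrite cx leye_eq.
  have [bw [wQ wG]] := fill_domain K0 mh mf h0 f0 Q0 G0 ml pr.
  eexists; split.
    apply: (fill_optimal (QLT := QLT) (GLT := GLT) K0 mh mf h0 f0 Q0 G0 aeg ml pr).
      by split=> //; split; [exact: wQ|exact: wG].
    rewrite /budget mul0r add0r big1 => [|m _]; last by rewrite mul0r.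
    by apply: integral_ge0 => x _; rewrite slope0 mul0r.
  apply: filterS aeg => x gx.
  have [i [hi [pk pi]]] := fill_dtdma K0 h0 f0 Q0 G0 ml pr gx.
  exists i; split=> //; split=> //.
  (* The inverse of the zero price is [+oo] and that of [h i x] is finite, so the minimum is the
     cap. *)
  rewrite pi slope0 {1}/einv eqxx /cap -/(min_ratio _ _).
  have hi0 : h i x != 0 by case/andP: gx => /forallP/(_ i) ? _; rewrite gt_eqF.
  by rewrite /einv (negbTE hi0) addye// /epos maxye miney.
Qed.
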